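(* Let $\mathcal{A}$ be a unital $C^*$-algebra, $\mathcal{H}$ a Hilbert $\mathcal{A}$-module, $K\in End_{\mathcal{A}}^{*}(\mathcal{H})$, and $\mathbb{J}\subseteq\mathbb{N}$ a finite or countable index set. For $n=1,2,\dots,k$, let $\{T_{n,i}\}_{i\in\mathbb{J}}\subset End_{\mathcal{A}}^{*}(\mathcal{H})$ be a $K$-operator frame for $End_{\mathcal{A}}^{*}(\mathcal{H})$ with bounds $A_n$ and $B_n$, and let $\{R_{n,i}\}_{i\in\mathbb{J}}\subset End_{\mathcal{A}}^{*}(\mathcal{H})$ be any sequence. Let $L:\ell^2(\mathcal{H})\to\ell^2(\mathcal{H})$ be a bounded linear operator such that, for some $p\in\{1,2,\dots,k\}$, $$L\Big(\Big\{\sum_{n=1}^{k}R_{n,i}(x)\Big\}_{i}\Big)=\{T_{p,i}(x)\}_{i}\qquad\text{for all }x\in\mathcal{H}.$$ If there exists a constant $\lambda>0$ such that $$\Big\|\sum_{i}\langle(T_{n,i}-R_{n,i})x,(T_{n,i}-R_{n,i})x\rangle\Big\|\le\lambda\Big\|\sum_{i}\langle T_{n,i}x,T_{n,i}x\rangle\Big\|\qquad\text{for all }x\in\mathcal{H},\ n=1,2,\dots,k,$$ then $\big\{\sum_{n=1}^{k}R_{n,i}\big\}_{i\in\mathbb{J}}$ is a $K$-operator frame for $End_{\mathcal{A}}^{*}(\mathcal{H})$.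
   Context: Hilbert $\mathcal{A}$-modules are left modules with $\mathcal{A}$-valued inner product $\langle\cdot,\cdot\rangle$, $\mathcal{A}$-linear in the first variable, with $\langle x,y\rangle=\langle y,x\rangle^*$, complete for $\|x\|=\|\langle x,x\rangle\|^{1/2}$. $End_{\mathcal{A}}^{*}(\mathcal{H})$ is the set of adjointable operators on $\mathcal{H}$. Inequalities between elements of $\mathcal{A}$ refer to the usual order given by the positive cone of $\mathcal{A}$. For $K\in End_{\mathcal{A}}^{*}(\mathcal{H})$, a family $\{T_i\}_{i\in\mathbb{J}}\subset End_{\mathcal{A}}^{*}(\mathcal{H})$ is a $K$-operator frame for $End_{\mathcal{A}}^{*}(\mathcal{H})$ with (lower and upper) bounds $A,B>0$ if $A\langle K^*x,K^*x\rangle\le\sum_{i\in\mathbb{J}}\langle T_ix,T_ix\rangle\le B\langle x,x\rangle$ for all $x\in\mathcal{H}$; it is a $K$-operator frame if such constants exist. $\ell^2(\mathcal{H})$ is the Hilbert $\mathcal{A}$-module of sequences $\{x_i\}_{i\in\mathbb{J}}$ in $\mathcal{H}$ with $\sum_i\langle x_i,x_i\rangle$ norm convergent, and $\|\{x_i\}_i\|=\|\sum_{i}\langle x_i,x_i\rangle\|^{1/2}$. Convention: all series of the form $\sum_{i\in\mathbb{J}}\langle T_ix,T_ix\rangle$ are taken to converge in norm in $\mathcal{A}$ (i.e. $\{T_ix\}_i\in\ell^2(\mathcal{H})$); this convergence is part of the notion of $K$-operator frame, and an inequality involving such series includes the assertion that the series appearing in it converge in norm. *)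

(* Defs.v *)
From HB Require Import structures.
From mathcomp Require Import all_boot all_order all_algebra.
From mathcomp Require Import complex.
From mathcomp Require Import all_classical all_reals all_analysis.

Set Implicit Arguments.
Unset Strict Implicit.
Unset Printing Implicit Defensive.

Import Order.TTheory GRing.Theory Num.Theory.
Import numFieldNormedType.Exports.

Local Open Scope classical_set_scope.
Local Open Scope ring_scope.
Local Open Scope complex_scope.

Reserved Notation "a ^#" (at level 1, format "a ^#").
Reserved Notation "a ⪯ b" (at level 70, no associativity).
Reserved Notation "⟨ x , y ⟩" (at level 0, x at level 99, y at level 99,
  format "⟨ x ,  y ⟩").

(* The hierarchy has no join of noncommutative rings with normed modules, so
   norms are explicit real-valued functions; convergence of norms is that of [R]. *)
Section NormConvergence.
Context {R : realType} {V : zmodType}.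
Implicit Types (N : V -> R) (u : nat -> V).

Definition norm_cvg N u (l : V) : Prop :=
  (fun n => N (u n - l)) @ \oo --> (0 : R).

Definition norm_cauchy N u : Prop :=
  forall e : R, 0 < e ->
    exists n0 : nat, forall m n, (n0 <= m)%N -> (n0 <= n)%N -> N (u m - u n) < e.

Definition norm_complete N : Prop :=
  forall u, norm_cauchy N u -> exists l, norm_cvg N u l.

End NormConvergence.

HB.mixin Record isCStarAlgebra (R : realType) A of GRing.Algebra R[i] A := {
  star : A -> A ;
  cnorm : A -> R ;
  starD : forall a b : A, star (a + b) = star a + star b ;
  starZ : forall (c : R[i]) (a : A), star (c *: a) = c^* *: star a ;
  starM : forall a b : A, star (a * b) = star b * star a ;
  starK : forall a : A, star (star a) = a ;
  cnormD : forall a b : A, cnorm (a + b) <= cnorm a + cnorm b ;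
  cnormZ : forall (c : R[i]) (a : A),
    (cnorm (c *: a))%:C = `|c| * (cnorm a)%:C ;
  cnorm_eq0 : forall a : A, cnorm a = 0 -> a = 0 ;
  cnormM : forall a b : A, cnorm (a * b) <= cnorm a * cnorm b ;
  cnorm_star : forall a : A, cnorm (star a * a) = cnorm a ^+ 2 ;
  cnorm_complete : norm_complete cnorm
}.

#[short(type="cstarAlgType")]
HB.structure Definition CStarAlgebra (R : realType) :=
  {A of GRing.Algebra R[i] A & isCStarAlgebra R A}.

Notation "a ^#" := (star a) : ring_scope.

Definition cstar_pos (R : realType) (A : cstarAlgType R) (a : A) : Prop :=
  exists b : A, a = b^# * b.

Definition cstar_le (R : realType) (A : cstarAlgType R) (a b : A) : Prop :=
  cstar_pos (b - a).

Notation "a ⪯ b" := (cstar_le a b) : ring_scope.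

(* Since A is unital, the complex scalar multiplication on a left A-module is
   determined by the action of A: c x = (c 1) x, i.e. [c%:A *: x]. *)
HB.mixin Record isHilbertModule (R : realType) (A : cstarAlgType R) H
    of GRing.Lmodule A H := {
  inner : H -> H -> A ;
  innerDl : forall x y z : H, inner (x + y) z = inner x z + inner y z ;
  innerZl : forall (a : A) (x y : H), inner (a *: x) y = a * inner x y ;
  innerC : forall x y : H, inner x y = (inner y x)^# ;
  inner_ge0 : forall x : H, 0 ⪯ inner x x ;
  inner_eq0 : forall x : H, inner x x = 0 -> x = 0 ;
  inner_complete : norm_complete (fun x => Num.sqrt (cnorm (inner x x)))
}.

#[short(type="hilbertModType")]
HB.structure Definition HilbertModule (R : realType) (A : cstarAlgType R) :=
  {H of GRing.Lmodule A H & isHilbertModule R A H}.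

Notation "⟨ x , y ⟩" := (inner x y) : ring_scope.

Section Adjointable.
Context {R : realType} {A : cstarAlgType R} {H : hilbertModType A}.

Definition is_adjoint (T S : H -> H) : Prop :=
  forall x y : H, ⟨T x, y⟩ = ⟨x, S y⟩.

Lemma inner0l (x : H) : ⟨0, x⟩ = 0.
Proof. by rewrite -(scale0r 0) innerZl mul0r. Qed.

Lemma innerNl (x y : H) : ⟨- x, y⟩ = - ⟨x, y⟩.
Proof. by rewrite -scaleN1r innerZl mulN1r. Qed.

Lemma star0 : (0 : A)^# = 0.
Proof. by apply: (addrI 0^#); rewrite -starD !addr0. Qed.

Lemma starN (a : A) : (- a)^# = - a^#.
Proof. by apply/eqP; rewrite -addr_eq0 -starD addNr star0. Qed.

Lemma inner0r (x : H) : ⟨x, 0⟩ = 0.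
Proof. by rewrite innerC inner0l star0. Qed.

Lemma innerDr (x y z : H) : ⟨x, y + z⟩ = ⟨x, y⟩ + ⟨x, z⟩.
Proof. by rewrite innerC innerDl starD -!innerC. Qed.

Lemma innerNr (x y : H) : ⟨x, - y⟩ = - ⟨x, y⟩.
Proof. by rewrite innerC innerNl starN -innerC. Qed.

Definition adjointable (T : H -> H) : bool := `[< exists S, is_adjoint T S >].

Lemma adjointable_zmod : zmod_closed adjointable.
Proof.
split=> [|T1 T2 /asboolP[S1 h1] /asboolP[S2 h2]]; apply/asboolP.
  by exists (fun=> 0) => x y; rewrite inner0l inner0r.
by exists (S1 - S2) => x y; rewrite innerDl innerNl innerDr innerNr h1 h2.
Qed.

HB.instance Definition _ :=
  GRing.isZmodClosed.Build (H -> H) adjointable adjointable_zmod.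

End Adjointable.

Record endStar (R : realType) (A : cstarAlgType R) (H : hilbertModType A) :=
  EndStar { endStar_fun :> H -> H ; endStarP : adjointable endStar_fun }.

Section EndStar.
Context {R : realType} {A : cstarAlgType R} {H : hilbertModType A}.

HB.instance Definition _ := [isSub for @endStar_fun R A H].
HB.instance Definition _ := [Choice of endStar H by <:].
HB.instance Definition _ := [SubChoice_isSubZmodule of endStar H by <:].

Definition adjoint (T : endStar H) : H -> H := sval (cid (asboolP _ (endStarP T))).

Lemma adjointP (T : endStar H) : is_adjoint T (adjoint T).
Proof. exact: svalP. Qed.

End EndStar.

Section Frames.
Context {R : realType} {A : cstarAlgType R} {H : hilbertModType A}.
Variable J : set nat.

(* Terms with index outside J are replaced by 0, so that the partial sums run
   over J in increasing order; the empty and finite J are included. *)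
Definition has_sum (f : J -> A) (s : A) : Prop :=
  norm_cvg cnorm (series (fun n => oapp f 0 (insub n))) s.

Definition l2_summable (x : J -> H) : Prop :=
  exists s, has_sum (fun i => ⟨x i, x i⟩) s.

Definition K_operator_frame_bounds (K : endStar H) (T : J -> endStar H)
    (a b : R) : Prop :=
  [/\ 0 < a, 0 < b &
    forall x : H, exists s : A,
      [/\ has_sum (fun i => ⟨T i x, T i x⟩) s,
          a%:C *: ⟨adjoint K x, adjoint K x⟩ ⪯ s &
          s ⪯ b%:C *: ⟨x, x⟩]].

Definition K_operator_frame (K : endStar H) (T : J -> endStar H) : Prop :=
  exists a b : R, K_operator_frame_bounds K T a b.

End Frames.

Record l2 (R : realType) (A : cstarAlgType R) (H : hilbertModType A)
    (J : set nat) :=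
  L2 { l2_fun :> J -> H ; l2P : l2_summable l2_fun }.

Section L2.
Context {R : realType} {A : cstarAlgType R} {H : hilbertModType A}.
Context {J : set nat}.

Definition l2_norm (u : l2 H J) : R := Num.sqrt (cnorm (sval (cid (l2P u)))).

(* Complex linearity and boundedness. The first clause says
   L (c u + v) = c L u + L v, where w ranges over the representatives of
   c u + v in l2, so that no vector space structure on [l2 H J] is needed. *)
Definition bounded_linear_l2 (L : l2 H J -> l2 H J) : Prop :=
  (forall (c : R[i]) (u v w : l2 H J),
     (forall i, w i = c%:A *: u i + v i) ->
     forall i, L w i = c%:A *: L u i + L v i) /\
  (exists M : R, forall u, l2_norm (L u) <= M * l2_norm u).

End L2.

(* Main.v *)
Require Import Defs.
From mathcomp Require Import all_boot all_order all_algebra.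
From mathcomp Require Import complex lra ring.
From mathcomp Require Import all_classical all_reals all_analysis.

Set Implicit Arguments.
Unset Strict Implicit.
Unset Printing Implicit Defensive.

Import Order.TTheory GRing.Theory Num.Theory.
Import numFieldNormedType.Exports.

Local Open Scope classical_set_scope.
Local Open Scope ring_scope.
Local Open Scope complex_scope.

(* Everything rests on one principle: if a is self-adjoint, b is positive and
   |h a h| <= r |h b h| for every self-adjoint h, then a <= r b. It follows by
   taking h = (b + e)^(-1/2), so that h b h has norm at most 1, hence
   h a h <= r, hence a <= r (b + e), and letting e tend to 0. The A-valued forms
   <x, x>, <K^* x, K^* x> and sum_i <U_i x, U_i x> are conjugated by h when x is
   replaced by h x, so norm inequalities valid for all x become inequalities in A.

   With U_i = sum_n R_{n,i}, square summability and the norm upper bound come from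
   the parallelogram law, as R_{n,i} = T_{n,i} - (T_{n,i} - R_{n,i}). The norm lower
   bound comes from A_p |K^* x|^2 <= |{T_{p,i} x}|^2 = |L {U_i x}|^2 <= M^2 |{U_i x}|^2.

   The positive cone is handled without spectral theory, as the set of squares of
   self-adjoint elements. Square roots come from a monotone iteration, and
   |1 - c^2| <= 1 for a self-adjoint contraction c because c + i sqrt (1 - c^2) is
   unitary. That b^* b is such a square (Fukamiya, Kaplansky) reduces to:
   x^* x = - c^2 implies x = 0. *)

(** * Norm and convergence in a C*-algebra *)

Lemma conj_realC (R : realType) (r : R) : Num.conj r%:C = r%:C.
Proof. by rewrite conj_Creal//; apply/complex_realP; exists r. Qed.

Lemma norm_realC (R : realType) (r : R) : `|r%:C| = `|r|%:C.
Proof. by rewrite normc_def /= expr0n addr0 sqrtr_sqr. Qed.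

Section CStarNorm.
Context {R : realType} {A : cstarAlgType R}.
Implicit Types (a b c d : A) (r s : R) (u v : nat -> A).

Lemma cnormZr r a : cnorm (r%:C *: a) = `|r| * cnorm a.
Proof.
by have := cnormZ r%:C a; rewrite norm_realC -rmorphM => /complexI.
Qed.

Lemma cnormN a : cnorm (- a) = cnorm a.
Proof.
by have := cnormZ (-1) a; rewrite scaleN1r normrN1 mul1r => /complexI.
Qed.

Lemma cnorm0 : cnorm (0 : A) = 0.
Proof. by rewrite -(scale0r (0 : A)) -[0 : R[i]]/(0%:C) cnormZr normr0 mul0r. Qed.

Lemma cnorm_ge0 a : 0 <= cnorm a.
Proof. by have := cnormD a (- a); rewrite subrr cnorm0 cnormN; lra. Qed.

Lemma cnormBC a b : cnorm (a - b) = cnorm (b - a).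
Proof. by rewrite -cnormN opprB. Qed.

Lemma cnormB a b : cnorm (a - b) <= cnorm a + cnorm b.
Proof. by rewrite -(cnormN b) cnormD. Qed.

Lemma cnorm_triangle a b c : cnorm (a - b) <= cnorm (a - c) + cnorm (c - b).
Proof. by have := cnormD (a - c) (c - b); rewrite addrA subrK. Qed.

Lemma star1 : (1 : A)^# = 1.
Proof. by rewrite -[LHS]mulr1 -[X in _ * X](starK 1) -starM mulr1 starK. Qed.

Lemma cnorm1_le1 : cnorm (1 : A) <= 1.
Proof.
have := cnorm_star (1 : A); rewrite star1 mulr1.
by have := cnorm_ge0 (1 : A); nra.
Qed.

Lemma starZr r a : (r%:C *: a)^# = r%:C *: a^#.
Proof. by rewrite starZ conj_realC. Qed.

Lemma starB a b : (a - b)^# = a^# - b^#.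
Proof. by rewrite starD starN. Qed.

(** From [|x|^2 = |x^# x| <= |x^#| |x|] one gets [|x| <= |x^#|]; applied to [x^#] this gives the
    reverse. *)
Lemma cnormS a : cnorm a^# = cnorm a.
Proof.
have le (x : A) : cnorm x <= cnorm x^#.
  have := cnormM x^# x; rewrite cnorm_star expr2.
  have := cnorm_ge0 x; have := cnorm_ge0 x^#.
  have [->|x0] := eqVneq (cnorm x) 0; first by lra.
  move=> h1 h2; rewrite ler_pM2r// lt_neqAle eq_sym x0; exact: h2.
by apply/eqP; rewrite eq_le le -{2}(starK a) le.
Qed.

Lemma cnorm_algr_le r : cnorm (r%:C%:A : A) <= `|r|.
Proof. by rewrite cnormZr; have := cnorm1_le1; have := normr_ge0 r; nra. Qed.

Lemma norm_cvg_le u a (w : nat -> R) :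
  (forall n, cnorm (u n - a) <= w n) -> w @ \oo --> (0 : R) ->
  norm_cvg cnorm u a.
Proof.
move=> h hw; apply: (squeeze_cvgr _ (cvg_cst 0) hw).
by near=> n; rewrite cnorm_ge0 h.
Unshelve. all: by end_near. Qed.

Lemma norm_cvg_near u a e : norm_cvg cnorm u a -> 0 < e ->
  exists n0, forall n, (n0 <= n)%N -> cnorm (u n - a) < e.
Proof.
move=> /cvgrPdist_lt h e0; have [n0 _ hn] := h e e0.
exists n0 => n /hn /=; rewrite sub0r normrN ger0_norm//; exact: cnorm_ge0.
Qed.

Lemma norm_cvgP u a :
  (forall e, 0 < e -> exists n0, forall n, (n0 <= n)%N -> cnorm (u n - a) < e) ->
  norm_cvg cnorm u a.
Proof.
move=> h; apply/cvgrPdist_lt => e /h [n0 hn]; exists n0 => // n /= /hn.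
by rewrite sub0r normrN ger0_norm// cnorm_ge0.
Qed.

Lemma norm_cvg_closed_ball u a b r : norm_cvg cnorm u a ->
  (forall n, cnorm (u n - b) <= r) -> cnorm (a - b) <= r.
Proof.
move=> ha h; apply/ler_addgt0Pl => e /(norm_cvg_near ha) [n0 /(_ n0 (leqnn _))].
rewrite cnormBC => hn.
by have := cnorm_triangle a b (u n0); have := h n0; lra.
Qed.

Lemma norm_cvg_unique u a b :
  norm_cvg cnorm u a -> norm_cvg cnorm u b -> a = b.
Proof.
move=> ha hb; apply/eqP; rewrite -subr_eq0; apply/eqP/cnorm_eq0/eqP.
rewrite eq_le cnorm_ge0 andbT; apply/ler_addgt0Pl => e e0; rewrite addr0.
have e2 : 0 < e / 2 by lra.
have [n hn] := norm_cvg_near ha e2; have [m hm] := norm_cvg_near hb e2.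
have := hn _ (leq_maxl n m); have := hm _ (leq_maxr n m).
have := cnorm_triangle a b (u (maxn n m)); rewrite (cnormBC a (u _)); lra.
Qed.

Lemma norm_cvgD u v a b : norm_cvg cnorm u a -> norm_cvg cnorm v b ->
  norm_cvg cnorm (fun n => u n + v n) (a + b).
Proof.
move=> ha hb; apply: (norm_cvg_le (w := fun n => cnorm (u n - a) + cnorm (v n - b))).
  by move=> n; rewrite opprD addrACA cnormD.
by rewrite -[0]addr0; apply: cvgD.
Qed.

Lemma norm_cvg_mul u a b c : norm_cvg cnorm u a ->
  norm_cvg cnorm (fun n => b * u n * c) (b * a * c).
Proof.
move=> ha.
apply: (norm_cvg_le (w := fun n => cnorm (u n - a) * (cnorm b * cnorm c))).
  move=> n; rewrite -mulrBl -mulrBr mulrA (mulrC _ (cnorm b)).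
  apply: le_trans (cnormM _ _) _; apply: ler_wpM2r (cnormM _ _).
  exact: cnorm_ge0.
by rewrite -[0](mul0r (cnorm b * cnorm c)); apply: cvgMr_tmp.
Qed.

Lemma norm_cvgN u a : norm_cvg cnorm u a ->
  norm_cvg cnorm (fun n => - u n) (- a).
Proof.
by move=> ha; apply: norm_cvg_le ha => n; rewrite -opprD cnormN.
Qed.

Lemma norm_cvgS u a : norm_cvg cnorm u a ->
  norm_cvg cnorm (fun n => (u n)^#) a^#.
Proof.
by move=> ha; apply: norm_cvg_le ha => n; rewrite -starB cnormS.
Qed.

Lemma norm_cvg_cst a : norm_cvg cnorm (fun=> a) a.
Proof.
by apply: norm_cvg_le (cvg_cst 0) => n; rewrite subrr cnorm0.
Qed.

Lemma norm_cvg_commute u a b : norm_cvg cnorm u a ->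
  (forall n, b * u n = u n * b) -> b * a = a * b.
Proof.
move=> ha h; apply: (norm_cvg_unique (u := fun n => b * u n * 1)).
  by rewrite -[b * a]mulr1; exact: norm_cvg_mul.
rewrite (_ : (fun n => _) = (fun n => 1 * u n * b)); last first.
  by apply/funext => n; rewrite mulr1 mul1r h.
by rewrite -[a * b]mul1r mulrA; exact: norm_cvg_mul.
Qed.

(** Method of majorants: [t] is nondecreasing and bounded, hence convergent, and its increments
    control those of [u]. It serves both the square root and the Neumann iterations. *)
Lemma majorant_cvg u (t : nat -> R) M :
  (forall n, cnorm (u n.+1 - u n) <= t n.+1 - t n) -> (forall n, t n <= M) ->
  exists a, norm_cvg cnorm u a.
Proof.
move=> ht tM; apply: cnorm_complete.
have uD (n d : nat) : cnorm (u (d + n)%N - u n) <= t (d + n)%N - t n.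
  elim: d => [|d IH]; first by rewrite add0n !subrr cnorm0.
  have := cnorm_triangle (u (d.+1 + n)%N) (u n) (u (d + n)%N).
  by have := ht (d + n)%N; rewrite addSn; lra.
have tcvg : cvgn t.
  apply: nondecreasing_is_cvgn.
    apply/nondecreasing_seqP => n.
    by have := ht n; have := cnorm_ge0 (u n.+1 - u n); lra.
  by exists M => _ [n _ <-].
move=> e e0; have e4 : 0 < e / 4 by lra.
have /cvgrPdist_lt /(_ _ e4) [n0 _ hn] := tcvg.
have key m : (n0 <= m)%N -> cnorm (u m - u n0) < e / 2.
  move=> hm; have := uD n0 (m - n0)%N; rewrite subnK//.
  have /= := hn _ hm; have /= := hn _ (leqnn n0).
  by rewrite !ltr_norml => /andP[? ?] /andP[? ?]; lra.
exists n0 => m n hm hn'; have := cnorm_triangle (u m) (u n) (u n0).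
have := key _ hm; have := key _ hn'; rewrite (cnormBC (u n)); lra.
Qed.

End CStarNorm.

(** * Squares of self-adjoint elements *)

Section Squares.
Context {R : realType} {A : cstarAlgType R}.
Implicit Types (a b c d x y z : A) (r s e : R).

Lemma cnorm_sqrB x y :
  cnorm (x * x - y * y) <= (cnorm x + cnorm y) * cnorm (x - y).
Proof.
have -> : x * x - y * y = x * (x - y) + (x - y) * y.
  by rewrite mulrBr mulrBl addrA subrK.
apply: le_trans (cnormD _ _) _; rewrite [leRHS]mulrDl [X in _ <= _ + X]mulrC.
exact: lerD (cnormM _ _) (cnormM _ _).
Qed.

Lemma halfD a : (2^-1 : R)%:C *: a + (2^-1 : R)%:C *: a = a.
Proof.
rewrite -scalerDl -rmorphD (_ : 2^-1 + 2^-1 = 1 :> R) ?scale1r//.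
by field.
Qed.

(* The iteration [y |-> (z + y ^ 2) / 2] has fixed point [1 - sqrt (1 - z)]; it
   is majorized by the scalar iteration with [z = 1]. *)
Lemma sqrt_1B z : z^# = z -> cnorm z <= 1 ->
  exists c, [/\ c^# = c, c * c = 1 - z, cnorm (1 - c) <= 1 &
    forall d, d * z = z * d -> d * c = c * d].
Proof.
move=> sz z1; pose h : R[i] := (2^-1 : R)%:C.
pose y n := iter n (fun y : A => h *: (z + y * y)) 0.
pose t n := iter n (fun t : R => (1 + t * t) / 2) 0.
have y0 : y 0%N = 0 by [].
have t0 : t 0%N = 0 by [].
have yS n : y n.+1 = h *: (z + y n * y n) by [].
have tS n : t n.+1 = (1 + t n * t n) / 2 by [].
move: y t y0 t0 yS tS => y t y0 t0 yS tS.
have t01 n : 0 <= t n <= 1.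
  elim: n => [|n /andP[? ?]]; first by rewrite t0; lra.
  by rewrite tS; apply/andP; split; nra.
have yt n : cnorm (y n) <= t n.
  elim: n => [|n IH]; first by rewrite y0 t0 cnorm0.
  rewrite yS tS cnormZr ger0_norm ?invr_ge0//.
  have := cnormD z (y n * y n); have := cnormM (y n) (y n).
  have := cnorm_ge0 (y n); have := t01 n; nra.
have stepB (u v : A) : cnorm (h *: (z + u * u) - h *: (z + v * v)) <=
    (cnorm u + cnorm v) * cnorm (u - v) / 2.
  rewrite -scalerBr opprD addrACA subrr add0r cnormZr ger0_norm ?invr_ge0//.
  by rewrite mulrC; apply: ler_wpM2r (cnorm_sqrB _ _); rewrite invr_ge0.
have ytB n : cnorm (y n.+1 - y n) <= t n.+1 - t n.
  elim: n => [|n IH].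
    rewrite yS tS y0 t0 !mul0r !addr0 !subr0 cnormZr.
    by rewrite ger0_norm ?invr_ge0//; lra.
  (* The increments of [t] satisfy with equality the estimate [stepB] for those of [y]. *)
  have -> : t n.+2 - t n.+1 = (t n.+1 + t n) * (t n.+1 - t n) / 2.
    by rewrite (tS n.+1) {3}(tS n); field.
  rewrite (yS n.+1) {3}(yS n); apply: le_trans (stepB _ _) _.
  apply: ler_wpM2r; first by rewrite invr_ge0.
  by apply: (ler_pM _ _ (lerD (yt _) (yt _)) IH); rewrite ?addr_ge0 ?cnorm_ge0//.
have [l yl] : exists l, norm_cvg cnorm y l.
  by apply: (majorant_cvg (t := t) (M := 1)) => // n; have /andP[] := t01 n.
have l1 : cnorm l <= 1.
  rewrite -[l]subr0; apply: (norm_cvg_closed_ball yl) => n.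
  by rewrite subr0; have := yt n; have := t01 n; lra.
(* The shifted sequence tends to [l], and also to [h (z + l^2)] because [|y n| + |l| <= 2]. *)
have lE : l = h *: (z + l * l).
  apply: (@norm_cvg_unique _ _ (fun n => y n.+1)).
    apply: norm_cvgP => e /(norm_cvg_near yl) [n0 hn]; exists n0 => n n0n.
    exact/hn/leqW.
  apply: (norm_cvg_le (w := fun n => cnorm (y n - l))); last exact: yl.
  move=> n; rewrite yS; apply: le_trans (stepB _ _) _.
  have := yt n; have := t01 n; have := cnorm_ge0 (y n - l).
  by move: (cnorm _) (cnorm _) (cnorm _) l1 => p q m; nra.
have yC d n : d * z = z * d -> d * y n = y n * d.
  move=> dz; elim: n => [|n IH]; first by rewrite y0 mulr0 mul0r.
  by rewrite yS -scalerAr -scalerAl mulrDr mulrDl dz mulrA IH -mulrA IH mulrA.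
have sy n : (y n)^# = y n.
  elim: n => [|n IH]; first by rewrite y0 star0.
  by rewrite yS starZr starD starM IH sz.
exists (1 - l); split.
- rewrite starB star1; congr (1 - _).
  apply: norm_cvg_unique (yl).
  by have := norm_cvgS yl; under eq_fun do rewrite sy.
- have l2 : l + l = z + l * l by rewrite {1 2}lE halfD.
  have -> : z = l + l - l * l by rewrite l2 addrK.
  rewrite mulrBl mul1r mulrBr mulr1 !opprB -addrA opprD; congr (1 + _).
  by rewrite addrCA.
- by rewrite opprB addrC subrK.
- move=> d dz; rewrite mulrBr mulrBl mulr1 mul1r; congr (_ - _).
  by apply: (norm_cvg_commute yl) => n; exact: yC.
Qed.

Lemma scaler_algC r a : r%:C%:A * a = a * r%:C%:A.
Proof. by rewrite mulr_algl -scalerAr mulr1. Qed.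

(** For self-adjoint [a], the condition [|r - a| <= r] is a norm form of positivity. Rescaling
    reduces to [z = 1 - a / r]; if [r = 0] then [a = 0]. The third conclusion says that the root
    satisfies the same condition with [sqrt r], hence is itself positive. *)
Lemma sqrt_ball r a : a^# = a -> 0 <= r -> cnorm (r%:C%:A - a) <= r ->
  exists c, [/\ c^# = c, c * c = a,
    cnorm ((Num.sqrt r)%:C%:A - c) <= Num.sqrt r &
    forall d, d * a = a * d -> d * c = c * d].
Proof.
move=> sa; rewrite le_eqVlt => /predU1P[<-|r0].
  rewrite scale0r sub0r cnormN => a0; exists 0.
  have -> : a = 0 by apply: cnorm_eq0; apply/eqP; rewrite eq_le a0 cnorm_ge0.
  by split=> [|||d _]; rewrite ?sqrtr0 ?scale0r ?subrr ?cnorm0 ?star0 ?mul0r ?mulr0.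
have rV : r * r^-1 = 1 by rewrite divff ?gt_eqF.
move=> ar; pose z := 1 - r^-1%:C *: a.
have za : r%:C *: (1 - z) = a.
  by rewrite opprB addrC subrK scalerA -rmorphM rV scale1r.
have sz : z^# = z by rewrite starB star1 starZr sa.
have z1 : cnorm z <= 1.
  have -> : z = r^-1%:C *: (r%:C%:A - a).
    by rewrite scalerBr scalerA -rmorphM mulrC rV scale1r.
  rewrite cnormZr ger0_norm; last by rewrite invr_ge0 ltW.
  by rewrite mulrC ler_pdivrMr// mul1r.
have [c [sc cc c1 cC]] := sqrt_1B sz z1.
exists ((Num.sqrt r)%:C *: c); split.
- by rewrite starZr sc.
- by rewrite -scalerAl -scalerAr cc scalerA -rmorphM -expr2 sqr_sqrtr// ltW.
- rewrite -scalerBr cnormZr (ger0_norm (sqrtr_ge0 r)) -[leRHS]mulr1.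
  by rewrite ler_wpM2l ?sqrtr_ge0.
- move=> d da; rewrite -scalerAl -scalerAr cC// mulrBr mulrBl mulr1 mul1r.
  by rewrite -scalerAl -scalerAr da.
Qed.

Lemma cnorm_sa_sqr c : c^# = c -> cnorm (c * c) = cnorm c ^+ 2.
Proof. by move=> sc; rewrite -cnorm_star sc. Qed.

(* [c + i d] is [sqrt r] times a unitary. *)
Lemma sqr_add_eq_scalar c d r : c^# = c -> d^# = d -> c * d = d * c ->
  0 <= r -> c * c + d * d = r%:C%:A -> cnorm (d * d) <= r.
Proof.
move=> sc sd cd r0 h; pose u := c + 'i *: d.
have su : u^# = c - 'i *: d by rewrite starD starZ sc sd conjCi scaleNr.
have uu : u^# * u = r%:C%:A.
  have -> : u^# * u = c * c - 'i *: (d * c) + ('i *: (c * d) - ('i * 'i) *: (d * d)).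
    by rewrite su mulrDr !mulrBl -!scalerAl -!scalerAr scalerA.
  by rewrite (_ : 'i * 'i = -1) -?expr2 ?sqrCi// scaleN1r opprK cd addrA subrK.
have ur : cnorm u ^+ 2 <= r.
  by rewrite -cnorm_star uu -[leRHS]ger0_norm// cnorm_algr_le.
(* [u - u^# = 2 i d], so [2 |d| <= |u| + |u^#| = 2 |u|]. *)
have d2u : cnorm d <= cnorm u.
  have := cnormB u u^#; rewrite cnormS.
  have -> : u - u^# = 'i *: (d + d).
    by rewrite su opprB addrC addrA subrK -scalerDr.
  have -> : d + d = (2 : R)%:C *: d by rewrite rmorphMn scaler_nat.
  rewrite scalerA mulrC -scalerA cnormZr ger0_norm//.
  have -> : cnorm ('i *: d) = cnorm d.
    by have := cnormZ 'i d; rewrite normCi mul1r => /complexI.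
  lra.
rewrite cnorm_sa_sqr//; apply: le_trans ur; rewrite ler_sqr// nnegrE cnorm_ge0//.
Qed.

(* The positive cone; that it contains every [b^# * b] is [sa_square_mulS]. *)
Definition sa_square a := exists c, c^# = c /\ a = c * c.

Lemma sa_square_sa a : sa_square a -> a^# = a.
Proof. by move=> [c [sc ->]]; rewrite starM sc. Qed.

Lemma sa_square_ball r a : a^# = a -> 0 <= r -> cnorm (r%:C%:A - a) <= r ->
  sa_square a.
Proof. by move=> sa r0 /(sqrt_ball sa r0) [c [sc cc _ _]]; exists c. Qed.

(** If [a = c^2], then [r - a] lies within distance [r] of [r], so it is a square [d^2] with [d]
    commuting with [c]; now [c^2 + d^2 = r] bounds [d^2]. *)
Lemma sa_square_dist r a : sa_square a -> cnorm a <= r ->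
  cnorm (r%:C%:A - a) <= r.
Proof.
move=> [c [sc ->]] cr; have r0 : 0 <= r := le_trans (cnorm_ge0 _) cr.
have sb : (r%:C%:A - c * c)^# = r%:C%:A - c * c.
  by rewrite starB starZr star1 starM sc.
have [|d [sd dd _ dC]] := sqrt_ball sb r0; first by rewrite opprB addrC subrK.
rewrite -dd; apply: (sqr_add_eq_scalar sc sd _ r0); last by rewrite dd addrC subrK.
by apply: dC; rewrite mulrBr mulrBl scaler_algC mulrA.
Qed.

Lemma sa_square_sqrt a : sa_square a ->
  exists c, [/\ sa_square c, c * c = a & forall d, d * a = a * d -> d * c = c * d].
Proof.
move=> pa; have [||c [sc cc c1 cC]] := @sqrt_ball (cnorm a) a (sa_square_sa pa).
- exact: cnorm_ge0.
- exact: sa_square_dist.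
exists c; split=> //; exact: sa_square_ball (sqrtr_ge0 _) c1.
Qed.

(** Commuting roots [c] of [a] and [d] of [r - a] satisfy [d^2 + c^2 = r], which bounds
    [c^2 = a]. *)
Lemma sa_square_norm_le r a : sa_square a -> 0 <= r ->
  sa_square (r%:C%:A - a) -> cnorm a <= r.
Proof.
move=> pa r0 [d [sd dd]]; have [c [/sa_square_sa sc cc cC]] := sa_square_sqrt pa.
rewrite -cc; apply: (sqr_add_eq_scalar sd sc _ r0).
  apply: cC; rewrite (_ : a = r%:C%:A - d * d); last first.
    by rewrite -dd opprB addrC subrK.
  by rewrite mulrBr mulrBl scaler_algC mulrA.
by rewrite cc -dd subrK.
Qed.

Lemma sa_square_sub r a : a^# = a -> cnorm a <= r -> sa_square (r%:C%:A - a).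
Proof.
move=> sa ar; apply: (@sa_square_ball r).
- by rewrite starB starZr star1 sa.
- exact: le_trans (cnorm_ge0 _) ar.
- by rewrite opprB addrC subrK.
Qed.

(** A sum of squares is not visibly a square, but the ball conditions of [a] and [b], with radii
    [|a|] and [|b|], add up. *)
Lemma sa_squareD a b : sa_square a -> sa_square b -> sa_square (a + b).
Proof.
move=> pa pb; apply: (@sa_square_ball (cnorm a + cnorm b)).
- by rewrite starD !sa_square_sa.
- by rewrite addr_ge0 ?cnorm_ge0.
- rewrite rmorphD scalerDl opprD addrACA; apply: le_trans (cnormD _ _) _.
  by apply: lerD; exact: sa_square_dist.
Qed.

Lemma sa_squareZ r a : 0 <= r -> sa_square a -> sa_square (r%:C *: a).
Proof.
move=> r0 [c [sc ->]]; exists ((Num.sqrt r)%:C *: c); split.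
  by rewrite starZr sc.
by rewrite -scalerAl -scalerAr scalerA -rmorphM -(expr2 (Num.sqrt r)) sqr_sqrtr.
Qed.

Lemma sa_square_alg r : 0 <= r -> sa_square (r%:C%:A : A).
Proof. by move=> r0; apply: sa_squareZ => //; exists 1; rewrite star1 mulr1. Qed.

Lemma sa_square0 : sa_square (0 : A).
Proof. by exists 0; rewrite star0 mulr0. Qed.

Lemma sa_square_mono a b : sa_square a -> sa_square (b - a) ->
  cnorm a <= cnorm b.
Proof.
move=> pa pba; apply: sa_square_norm_le => //; first exact: cnorm_ge0.
have -> : (cnorm b)%:C%:A - a = ((cnorm b)%:C%:A - b) + (b - a).
  by rewrite addrA subrK.
apply: sa_squareD (pba); apply: sa_square_sub => //; apply: sa_square_sa.
by rewrite -(subrK a b); exact: sa_squareD pba pa.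
Qed.

(** The ball condition passes to the limit: it is used for [u n] with radius [|a| + e / 4], at the
    cost of two more errors [e / 4]. *)
Lemma sa_square_closed (u : nat -> A) a : (forall n, sa_square (u n)) ->
  norm_cvg cnorm u a -> sa_square a.
Proof.
move=> pu ua; have sa : a^# = a.
  apply: norm_cvg_unique (ua); have := norm_cvgS ua.
  by under eq_fun do rewrite sa_square_sa//.
apply: (sa_square_ball sa (cnorm_ge0 a)); apply/ler_addgt0Pl => e e0.
have e4 : 0 < e / 4 by lra.
have [n /(_ n (leqnn _)) hn] := norm_cvg_near ua e4.
have un : cnorm (u n) <= cnorm a + e / 4.
  by have := cnorm_triangle (u n) 0 a; rewrite !subr0; lra.
have -> : (cnorm a)%:C%:A - a =
    ((cnorm a + e / 4)%:C%:A - u n) + (u n - a - (e / 4)%:C%:A).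
  by rewrite rmorphD scalerDl !addrA subrK addrAC addrK.
have := cnormD ((cnorm a + e / 4)%:C%:A - u n) (u n - a - (e / 4)%:C%:A).
have := sa_square_dist (pu n) un; have := cnormB (u n - a) (e / 4)%:C%:A.
by have := cnorm_algr_le (e / 4) (A := A); rewrite (ger0_norm (ltW e4)); lra.
Qed.
End Squares.

(** * Positivity of [b^# * b] *)

Section Positivity.
Context {R : realType} {A : cstarAlgType R}.
Implicit Types (a b c d x y z : A) (r s e : R).

(** With [u] and [v] twice the real and, up to sign, twice the imaginary part of [x], one has
    [u^2 + v^2 = 2 (x x^# + x^# x)]. *)
Lemma sa_square_starC x : sa_square (x * x^# + x^# * x).
Proof.
pose u := x + x^#; pose v := 'i *: (x - x^#).
have su : u^# = u by rewrite starD starK addrC.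
have sv : v^# = v.
  by rewrite starZ starB starK conjCi scaleNr -scalerN opprB.
have ii : 'i * 'i = -1 :> R[i] by rewrite -expr2 sqrCi.
have uv : u * u + v * v = (2 : R)%:C *: (x * x^# + x^# * x).
  rewrite -scalerAl -scalerAr scalerA ii scaleN1r.
  rewrite !(mulrDl, mulrDr, mulrNN, mulrN, mulNr) rmorphMn scaler_nat.
  rewrite !opprD !opprK addrACA [x * x + _ + _]addrACA subrr add0r.
  by rewrite [X in _ + X = _]addrACA subrr addr0 mulr2n [RHS]addrACA.
have -> : x * x^# + x^# * x = (2^-1 : R)%:C *: (u * u + v * v).
  by rewrite uv scalerA -rmorphM mulVf ?scale1r// pnatr_eq0.
by apply: sa_squareZ; [rewrite invr_ge0 | apply: sa_squareD; [exists u | exists v]].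
Qed.

(* With [x x^# = g ^ 2] one gets [x (1 + s c ^ 2) = (1 - s g ^ 2) x], so that
   right multiplication by [1 + s c ^ 2] does not increase the norm of [x].
   For [q = c ^ 2] and [m = |q|] this yields [q + 2 s q ^ 2 <= m], which together
   with [(q - m) ^ 2 >= 0] gives [(1 + 4 s m) q <= m (1 + 2 s m)], so [m = 0]. *)
Lemma mulS_opp_square x c : c^# = c -> x^# * x = - (c * c) -> x = 0.
Proof.
move=> sc xx; pose q := c * c; pose m := cnorm q.
have sq : q^# = q by rewrite starM sc.
have [g [sg gg]] : sa_square (x * x^#).
  have -> : x * x^# = (x * x^# + x^# * x) + c * c by rewrite xx subrK.
  by apply: sa_squareD; [exact: sa_square_starC | exists c].
have m0 : 0 <= m := cnorm_ge0 _.
pose k := cnorm (x * x^#); have k0 : 0 <= k := cnorm_ge0 _.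
have k1 : 0 < 1 + k by rewrite ltr_pwDl.
(* This choice makes [s x x^#] a positive contraction, so that [|1 - s x x^#| <= 1]. *)
pose s := (1 + k)^-1; have s0 : 0 < s by rewrite invr_gt0.
have sk : s * k <= 1 by rewrite mulrC ler_pdivrMr// mul1r; lra.
pose t : A := 1 + s%:C *: q.
have st : t^# = t by rewrite starD star1 starZr sq.
have xt : x * t = (1 - s%:C *: (x * x^#)) * x.
  by rewrite mulrBl mul1r -scalerAl -mulrA xx mulrN scalerN opprK mulrDr mulr1 -scalerAr.
have nxt : cnorm (x * t) <= cnorm x.
  rewrite xt; apply: le_trans (cnormM _ _) _; apply: ler_piMl; first exact: cnorm_ge0.
  rewrite -(scale1r (1 : A)) -[1 : R[i]]/((1 : R)%:C); apply: sa_square_dist.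
    by apply: sa_squareZ; [exact: ltW | exists g].
  by rewrite cnormZr (ger0_norm (ltW s0)).
have qt : q * t = t * q by rewrite mulrDr mulrDl mulr1 mul1r -scalerAr -scalerAl.
have n1 : cnorm (t * q * t) <= m.
  have -> : t * q * t = - ((x * t)^# * (x * t)).
    by rewrite starM st mulrA -[_ * _ * x]mulrA xx mulrN mulNr opprK.
  rewrite cnormN cnorm_star.
  have -> : m = cnorm x ^+ 2 by rewrite -cnorm_star xx cnormN.
  by rewrite ler_sqr ?nnegrE ?cnorm_ge0.
pose q2 := q + (2 * s)%:C *: (q * q).
(* [t q t = q + 2 s q^2 + s^2 q^3], and [q^3 = (q c)^2] is positive, so [q2] lies below [t q t]. *)
have tqt : t * q * t = q2 + (s%:C *: (q * c)) * (s%:C *: (q * c)).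
  rewrite -qt -mulrA.
  have -> : t * t = 1 + (2 * s)%:C *: q + (s * s)%:C *: (q * q).
    rewrite mulrDr mulr1 mulrDl mul1r -scalerAl -scalerAr scalerA.
    by rewrite mulrDl mul1r !rmorphM !rmorphD /= scalerDl !addrA.
  rewrite !mulrDr mulr1 -!scalerAr -scalerAl scalerA -rmorphM; congr (_ + _ *: _).
  have cq : c * q = q * c by rewrite mulrA.
  by rewrite -[RHS]mulrA [c * (q * c)]mulrA cq -[q * c * c]mulrA.
have sq2 : sa_square q2.
  apply: sa_squareD; first by exists c.
  by apply: sa_squareZ; [rewrite mulr_ge0// ltW | exists q].
have q2m : cnorm q2 <= m.
  apply: le_trans n1; rewrite tqt; apply: sa_square_mono => //.
  rewrite addrC addKr; exists (s%:C *: (q * c)); split=> //.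
  by rewrite starZr starM sc sq mulrA.
pose M := m * (1 + 2 * s * m); pose N := 1 + 4 * s * m.
have MN : M%:C%:A - N%:C *: q =
    (m%:C%:A - q2) + (2 * s)%:C *: ((q - m%:C%:A) * (q - m%:C%:A)).
  have -> : M%:C%:A = m%:C%:A + (2 * s)%:C *: (m%:C *: m%:C%:A) :> A.
    by rewrite !scalerA -!rmorphM -scalerDl -rmorphD; congr (_%:C *: _); rewrite /M; ring.
  have -> : N%:C *: q = q + (2 * s)%:C *: (m%:C *: q) + (2 * s)%:C *: (m%:C *: q).
    rewrite !scalerA -!rmorphM -{2}(scale1r q) -!scalerDl -[1 : R[i]]/((1 : R)%:C).
    by rewrite -!rmorphD; congr (_%:C *: _); rewrite /N; ring.
  rewrite mulrBl !mulrBr -scaler_algC !mulr_algl !scalerBr.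
  move: (_ *: (m%:C *: q)) (_ *: (m%:C *: m%:C%:A)) => d b.
  rewrite /q2 !opprD opprK !addrA subrK.
  by rewrite [m%:C%:A + b - q]addrAC !(addrAC _ b).
have sm0 : 0 <= s * m by rewrite mulr_ge0// ltW.
have MNle : cnorm (N%:C *: q) <= M.
  apply: sa_square_norm_le.
  - apply: sa_squareZ; first by rewrite /N; lra.
    by exists c.
  - by rewrite /M mulr_ge0//; lra.
  rewrite MN; apply: sa_squareD; first by apply: sa_square_sub => //; exact: sa_square_sa.
  apply: sa_squareZ; first by lra.
  by exists (q - m%:C%:A); rewrite starB starZr star1 sq.
have mm0 : m = 0.
  move: MNle; rewrite cnormZr ger0_norm -/m /M /N; last by lra.
  by move=> ?; have : s * m * m <= 0 by [lra]; rewrite -mulrA pmulr_rle0//; nra.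
apply: cnorm_eq0; apply/eqP; rewrite -sqrf_eq0 -cnorm_star xx cnormN.
by rewrite -/q -/m mm0.
Qed.

(** Let [k] be the positive root of [a^2] and [m = k - a], twice the negative part of [a]. Then
    [m a = - m k], so [(b m)^# (b m) = - (f m)^2] with [f^2 = k], which forces [b m = 0]. Hence
    [f m = 0], then [m k = m a = 0] and [m^2 = 0], so [a = k]. *)
Lemma sa_square_mulS b : sa_square (b^# * b).
Proof.
pose a := b^# * b; have sa : a^# = a by rewrite starM starK.
have [k [pk kk kC]] : exists k, [/\ sa_square k, k * k = a * a &
    forall d, d * (a * a) = a * a * d -> d * k = k * d].
  by apply: sa_square_sqrt; exists a.
have ak : a * k = k * a by apply: kC; rewrite mulrA.
have [f [/sa_square_sa sf ff fC]] := sa_square_sqrt pk.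
pose m := k - a; have sm : m^# = m by rewrite starB sa (sa_square_sa pk).
have mk : m * k = k * m by rewrite mulrBl mulrBr ak.
have fm : m * f = f * m by apply: fC.
have ma : m * a = - (m * k) by rewrite mulrBl mulrBl kk ak opprB.
have bm0 : b * m = 0.
  apply: (@mulS_opp_square _ (f * m)); first by rewrite starM sm sf fm.
  have -> : (b * m)^# * (b * m) = m * a * m by rewrite starM sm !mulrA.
  by rewrite ma mulNr -ff mulrA fm -!mulrA.
have fm0 : f * m = 0.
  apply: cnorm_eq0; apply/eqP; rewrite -sqrf_eq0 -cnorm_star starM sm sf.
  rewrite mulrA -[m * f * f]mulrA ff -[_ * _ * m]opprK -mulNr -ma.
  by rewrite /a -!mulrA bm0 !mulr0 oppr0 cnorm0.
have mk0 : m * k = 0 by rewrite mk -ff -mulrA fm0 mulr0.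
have m0 : m = 0.
  apply: cnorm_eq0; apply/eqP; rewrite -sqrf_eq0 -cnorm_star sm {2}/m.
  by rewrite mulrBr ma mk0 oppr0 subrr cnorm0.
by rewrite -/a -(subKr k a) -/m m0 subr0.
Qed.

Lemma cstar_posP a : cstar_pos a <-> sa_square a.
Proof.
by split=> [[b ->]|[c [sc ->]]]; [exact: sa_square_mulS | exists c; rewrite sc].
Qed.

Lemma sa_square_conj a x : sa_square a -> sa_square (x^# * a * x).
Proof.
move=> [c [sc ->]]; have -> : x^# * (c * c) * x = (c * x)^# * (c * x).
  by rewrite starM sc !mulrA.
exact: sa_square_mulS.
Qed.

End Positivity.

(** * From norm inequalities to inequalities in the algebra *)

Section Domination.
Context {R : realType} {A : cstarAlgType R}.
Implicit Types (a b c d x y z : A) (r s e : R).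

(** The iterates are the partial sums of the Neumann series, majorized by those of the geometric
    series of ratio [r = |z|]. *)
Lemma neumann z : z^# = z -> cnorm z < 1 ->
  exists v, [/\ v^# = v, v * (1 - z) = 1 &
    forall d, d * z = z * d -> d * v = v * d].
Proof.
move=> sz; set r := cnorm z => r1; have r0 : 0 <= r := cnorm_ge0 z.
pose y n := iter n (fun y : A => 1 + z * y) 0.
pose t n := iter n (fun t : R => 1 + r * t) 0.
have y0 : y 0%N = 0 by []. have t0 : t 0%N = 0 by [].
have yS n : y n.+1 = 1 + z * y n by [].
have tS n : t n.+1 = 1 + r * t n by [].
move: y t y0 t0 yS tS => y t y0 t0 yS tS.
have tM n : t n <= (1 - r)^-1.
  have h : (1 - r) * (1 - r)^-1 = 1 by rewrite divff// gt_eqF// subr_gt0.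
  elim: n => [|n IH]; first by rewrite t0 invr_ge0 subr_ge0 ltW.
  by rewrite tS; nra.
have ytB n : cnorm (y n.+1 - y n) <= t n.+1 - t n.
  elim: n => [|n IH].
    by rewrite yS tS y0 t0 !mulr0 !addr0 !subr0 cnorm1_le1.
  rewrite (yS n.+1) {2}(yS n) (tS n.+1) {2}(tS n).
  rewrite !opprD !addrA ![1 + _ - 1]addrAC !subrr !add0r -!mulrBr.
  exact: le_trans (cnormM _ _) (ler_wpM2l r0 IH).
have [l yl] := majorant_cvg ytB tM.
have lE : l = 1 + z * l.
  apply: (@norm_cvg_unique _ _ (fun n => y n.+1)).
    apply: norm_cvgP => e /(norm_cvg_near yl) [n0 hn]; exists n0 => n n0n.
    exact/hn/leqW.
  under eq_fun do rewrite yS -[z * _]mulr1; rewrite -[z * l]mulr1.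
  by apply: norm_cvgD; [exact: norm_cvg_cst | exact: norm_cvg_mul].
have yC d : d * z = z * d -> d * l = l * d.
  move=> dz; apply: (norm_cvg_commute yl); elim=> [|n IH].
    by rewrite y0 mulr0 mul0r.
  by rewrite yS mulrDr mulrDl mulr1 mul1r mulrA dz -!mulrA IH.
have ll : (1 - z) * l = 1 by rewrite mulrBl mul1r {1}lE addrK.
have lr : l * (1 - z) = 1.
  by rewrite -[RHS]ll mulrBr mulrBl mulr1 mul1r yC.
exists l; split=> //.
(* The left inverse [l^#] and the right inverse [l] of [1 - z] coincide. *)
have sl : l^# * (1 - z) = 1 by have := congr1 star ll; rewrite starM starB star1 sz.
by rewrite -[LHS]mulr1 -ll mulrA sl mul1r.
Qed.

(** [w] is the root of [a + e] and [h] its inverse. Dividing [a + e] by [r = |a| + e] gives [1 - z]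
    with [|z| <= |a| / r < 1], which is invertible; [1 - h a h = e h^2] bounds [h a h]. *)
Lemma inv_sqrt_shift a e : sa_square a -> 0 < e ->
  exists h w, [/\ h^# = h, w^# = w, w * h = 1, w * w = a + e%:C%:A &
    cnorm (h * a * h) <= 1].
Proof.
move=> pa e0; set b := a + e%:C%:A.
have sa := sa_square_sa pa.
have pb : sa_square b by apply: sa_squareD => //; apply: sa_square_alg; exact: ltW.
have [w [/sa_square_sa sw ww wC]] := sa_square_sqrt pb.
have a0 : 0 <= cnorm a := cnorm_ge0 a.
pose r := cnorm a + e; have r0 : 0 < r by rewrite /r; lra.
have rV : r^-1 * r = 1 by rewrite mulVf// gt_eqF.
pose z := 1 - r^-1%:C *: b.
have sz : z^# = z by rewrite starB star1 starZr (sa_square_sa pb).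
have z1 : cnorm z < 1.
  have -> : z = r^-1%:C *: ((cnorm a)%:C%:A - a).
    rewrite -[_ - a](addrKA e%:C%:A) -scalerDl -rmorphD [_ + a]addrC.
    by rewrite scalerBr scalerA -rmorphM rV scale1r.
  rewrite cnormZr ger0_norm; last by rewrite invr_ge0 ltW.
  rewrite mulrC ltr_pdivrMr// mul1r; have := sa_square_dist pa (lexx _).
  by rewrite /r; lra.
have [v [sv vz vC]] := neumann sz z1.
have wz : w * z = z * w.
  by rewrite mulrBr mulrBl mulr1 mul1r -scalerAr -scalerAl -ww mulrA.
have wv := vC _ wz.
pose h := r^-1%:C *: (w * v).
have sh : h^# = h by rewrite starZr starM sw sv -wv.
have wh : w * h = 1.
  rewrite -scalerAr mulrA ww -[RHS]vz vC; last first.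
    by rewrite mulrBr mulrBl mulr1 mul1r -scalerAr -scalerAl.
  by rewrite scalerAr opprB addrC subrK.
have hw : h * w = 1 by rewrite -star1 -wh starM sh sw.
exists h, w; split=> //; apply: sa_square_norm_le => //.
  by rewrite -{1}sh; exact: sa_square_conj.
have -> : (1 : R)%:C%:A - h * a * h = e%:C *: (h * h).
  have -> : a = w * w - e%:C%:A by rewrite ww addrK.
  rewrite mulrBr mulrBl mulrA hw mul1r wh -scaler_algC -mulrA mulr_algl.
  by rewrite [(1 : R)%:C]/(1 : R[i]) scale1r opprB addrC subrK.
by apply: sa_squareZ; [exact: ltW | exists h].
Qed.

(* Applied with [h = (b + e) ^ (-1/2)], for which [h b h] has norm at most 1. *)
Lemma le_of_cnorm_conj_le a b r : a^# = a -> sa_square b -> 0 <= r ->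
  (forall h, h^# = h -> cnorm (h * a * h) <= r * cnorm (h * b * h)) ->
  a ⪯ r%:C *: b.
Proof.
move=> sa pb r0 hle; apply/cstar_posP.
apply: (@sa_square_closed _ _ (fun n => r%:C *: (b + (n.+1%:R^-1)%:C%:A) - a)).
  move=> n; have n0 : 0 < n.+1%:R^-1 :> R by rewrite invr_gt0.
  have [h [w [sh sw wh ww hbh]]] := inv_sqrt_shift pb n0.
  have hw : h * w = 1 by rewrite -star1 -wh starM sh sw.
  (* The conjugation is undone by [w]: since [|h a h| <= r |h b h| <= r], the element [r - h a h] is
     positive, and so is its conjugate. *)
  have -> : r%:C *: (b + (n.+1%:R^-1)%:C%:A) - a = w^# * (r%:C%:A - h * a * h) * w.
    rewrite sw mulrBr mulrBl -scaler_algC -[_ * w * w]mulrA mulr_algl ww; congr (_ - _).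
    by rewrite !mulrA wh mul1r -mulrA hw mulr1.
  apply: sa_square_conj; apply: sa_square_sub; first by rewrite !starM sh sa mulrA.
  by have := hle h sh; have := cnorm_ge0 (h * b * h); nra.
apply: (norm_cvg_le (w := fun n => r * n.+1%:R^-1)).
  move=> n; rewrite opprB addrA subrK scalerDr addrAC subrr add0r.
  rewrite scalerA -rmorphM; apply: le_trans (cnorm_algr_le _) _.
  by rewrite ger0_norm// mulr_ge0.
rewrite -[0](mulr0 r); apply: cvgMl_tmp; exact: cvg_harmonic.
Qed.

End Domination.

(** * Square-summable families *)

Section HilbertModules.
Context {R : realType} {A : cstarAlgType R} {H : hilbertModType A}.
Implicit Types (a h s t : A) (x y z : H).

Lemma innerZr a x y : ⟨x, a *: y⟩ = ⟨x, y⟩ * a^#.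
Proof. by rewrite innerC innerZl starM -innerC. Qed.

Lemma inner_sa_square x : sa_square ⟨x, x⟩.
Proof. by apply/cstar_posP; have := inner_ge0 x; rewrite /cstar_le subr0. Qed.

Lemma inner_separating x y : (forall z, ⟨x, z⟩ = ⟨y, z⟩) -> x = y.
Proof.
move=> h; apply/eqP; rewrite -subr_eq0; apply/eqP/inner_eq0.
by rewrite innerDl innerNl h subrr.
Qed.

Lemma is_adjoint_sym (T S : H -> H) : is_adjoint T S -> is_adjoint S T.
Proof. by move=> TS x y; rewrite innerC -TS -innerC. Qed.

(** Compatibility with scalars of [A] is not a field of [endStar]; it follows from the existence of
    an adjoint, as the inner product separates points. *)
Lemma is_adjointZ (T S : H -> H) a x : is_adjoint T S -> T (a *: x) = a *: T x.
Proof. by move=> TS; apply: inner_separating => z; rewrite TS !innerZl TS. Qed.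

Lemma endStarZ (T : endStar H) a x : T (a *: x) = a *: T x.
Proof. exact: is_adjointZ (@adjointP _ _ _ T). Qed.

Lemma adjoint_endStarZ (T : endStar H) a x :
  adjoint T (a *: x) = a *: adjoint T x.
Proof. exact/is_adjointZ/is_adjoint_sym/(@adjointP _ _ _ T). Qed.

Lemma endStarB (T S : endStar H) x : (T - S) x = T x - S x.
Proof. by []. Qed.

Lemma endStar_sum (I : Type) (r : seq I) (F : I -> endStar H) x :
  (\sum_(i <- r) F i) x = \sum_(i <- r) F i x.
Proof. by elim: r => [|i r IH]; rewrite ?big_nil// !big_cons -IH. Qed.

Lemma inner_parallelogram x y :
  ⟨x + y, x + y⟩ + ⟨x - y, x - y⟩ = ⟨x, x⟩ + ⟨x, x⟩ + (⟨y, y⟩ + ⟨y, y⟩).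
Proof.
rewrite !(innerDl, innerDr, innerNl, innerNr) opprB addrACA.
rewrite [⟨x, x⟩ + ⟨y, x⟩ + _]addrACA subrr addr0; congr (_ + _).
by rewrite [⟨x, y⟩ + _]addrC addrACA subrr addr0.
Qed.

End HilbertModules.

(** * Series of positive elements *)

Section Series.
Context {R : realType} {A : cstarAlgType R}.
Implicit Types (s t : A) (f g : nat -> A).

Lemma sa_square_sum f (m n : nat) : (forall i, sa_square (f i)) ->
  sa_square (\sum_(m <= i < n) f i).
Proof. by move=> pf; apply: big_ind => //; [exact: sa_square0 | exact: sa_squareD]. Qed.

Lemma series_sa_square f s : (forall n, sa_square (f n)) ->
  norm_cvg cnorm (series f) s -> sa_square s.
Proof. by move=> pf; apply: sa_square_closed => n; exact: sa_square_sum. Qed.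

(** Comparison test: blocks of [f] are dominated in order, hence in norm, by blocks of [g]; [t - s]
    is positive as a limit of differences of partial sums. *)
Lemma series_dominated f g t : (forall n, sa_square (f n)) ->
  (forall n, sa_square (g n - f n)) -> norm_cvg cnorm (series g) t ->
  exists s, norm_cvg cnorm (series f) s /\ cnorm s <= cnorm t.
Proof.
move=> pf pgf gt.
have le_fg m n : (m <= n)%N ->
    cnorm (series f n - series f m) <= cnorm (series g n - series g m).
  move=> mn; rewrite !sub_series_geq//; apply: sa_square_mono.
    exact: sa_square_sum.
  by rewrite -sumrB; exact: sa_square_sum.
have [s fs] : exists s, norm_cvg cnorm (series f) s.
  apply: cnorm_complete => e e0; have e2 : 0 < e / 2 by lra.
  have [n0 hn] := norm_cvg_near gt e2; exists n0.
  suff key m n : (n0 <= m)%N -> (m <= n)%N -> cnorm (series f n - series f m) < e.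
    move=> m n hm hn'; have [mn|/ltnW nm] := leqP m n; last exact: key.
    by rewrite cnormBC; exact: key.
  move=> hm mn; apply: le_lt_trans (le_fg _ _ mn) _.
  have := hn _ hm; have := hn _ (leq_trans hm mn).
  by have := cnorm_triangle (series g n) (series g m) t; rewrite (cnormBC t); lra.
exists s; split=> //; apply: sa_square_mono; first exact: series_sa_square fs.
apply: (sa_square_closed (u := fun n => series g n + - series f n)).
  by move=> n; rewrite /series -sumrB; exact: sa_square_sum.
exact: norm_cvgD (norm_cvgN fs).
Qed.

End Series.

(** * Sums of inner products over the index set *)

Section SquareSummable.
Context {R : realType} {A : cstarAlgType R} {H : hilbertModType A}.
Variable J : set nat.
Implicit Types (s t : A) (x y : J -> H).

(** Padding by zero in [H] instead of [A] gives the same series of inner products and allows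
    termwise computation in the module. *)
Definition zero_ext x n : H := oapp x 0 (insub n).

Lemma has_sum_innerE x s : has_sum (fun i => ⟨x i, x i⟩) s =
  norm_cvg cnorm (series (fun n => ⟨zero_ext x n, zero_ext x n⟩)) s.
Proof.
congr (norm_cvg _ (series _) _); apply/funext => n; rewrite /zero_ext.
by case: insub => //=; rewrite inner0l.
Qed.

Lemma has_sum_unique (f : J -> A) s t : has_sum f s -> has_sum f t -> s = t.
Proof. exact: norm_cvg_unique. Qed.

Lemma has_sum_inner_sa_square x s :
  has_sum (fun i => ⟨x i, x i⟩) s -> sa_square s.
Proof.
rewrite has_sum_innerE; apply: series_sa_square => n; exact: inner_sa_square.
Qed.

Lemma has_sum_innerN x s : has_sum (fun i => ⟨x i, x i⟩) s ->
  has_sum (fun i => ⟨- x i, - x i⟩) s.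
Proof.
by congr (has_sum _ _); apply/funext => i; rewrite innerNl innerNr opprK.
Qed.

Lemma has_sum_innerZ x s h : has_sum (fun i => ⟨x i, x i⟩) s ->
  has_sum (fun i => ⟨h *: x i, h *: x i⟩) (h * s * h^#).
Proof.
rewrite !has_sum_innerE => /(@norm_cvg_mul _ _ _ _ h h^#).
congr (norm_cvg _ _ _); apply/funext => n.
rewrite /series /= mulr_sumr mulr_suml; apply: eq_bigr => i _.
have -> : zero_ext (fun i => h *: x i) i = h *: zero_ext x i.
  by rewrite /zero_ext; case: insub => //=; rewrite scaler0.
by rewrite innerZl innerZr mulrA.
Qed.

(** By the parallelogram law, [2 <x, x> + 2 <y, y>] exceeds [<x + y, x + y>] by the positive term
    [<x - y, x - y>], so the comparison test applies. *)
Lemma has_sum_innerD x y s t : has_sum (fun i => ⟨x i, x i⟩) s ->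
  has_sum (fun i => ⟨y i, y i⟩) t ->
  exists r, has_sum (fun i => ⟨x i + y i, x i + y i⟩) r /\
    cnorm r <= 2 * (cnorm s + cnorm t).
Proof.
rewrite !has_sum_innerE => xs yt.
have xxyy := norm_cvgD (norm_cvgD xs xs) (norm_cvgD yt yt).
set f := fun n => ⟨zero_ext x n, zero_ext x n⟩ in xs xxyy.
set g := fun n => ⟨zero_ext y n, zero_ext y n⟩ in yt xxyy.
have [|||r [xyr rle]] := @series_dominated _ _
  (fun n => ⟨zero_ext x n + zero_ext y n, zero_ext x n + zero_ext y n⟩)
  (fun n => f n + f n + (g n + g n)) (s + s + (t + t)).
- by move=> n; exact: inner_sa_square.
- by move=> n; rewrite -inner_parallelogram addrC addKr; exact: inner_sa_square.
- move: xxyy; congr (norm_cvg _ _ _); apply/funext => n.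
  by rewrite /series /= -!big_split.
exists r; split; last first.
  apply: le_trans rle _; apply: le_trans (cnormD _ _) _.
  by have := cnormD s s; have := cnormD t t; lra.
rewrite has_sum_innerE; move: xyr; congr (norm_cvg _ (series _) _).
apply/funext => n; rewrite /zero_ext; case: insub => //=.
by rewrite addr0.
Qed.

(** The point is that [C] does not depend on [x]: each added family turns it into
    [2 (|c n| + C)]. *)
Lemma has_sum_inner_sum (X I : Type) (N : X -> R) (F : X -> I -> J -> H)
    (c : I -> R) (r : seq I) :
  (forall x : X, 0 <= N x) ->
  (forall (x : X) n, exists s, has_sum (fun i => ⟨F x n i, F x n i⟩) s /\
    cnorm s <= c n * N x) ->
  exists C, 0 <= C /\ forall x : X, exists s,
    has_sum (fun i => ⟨\sum_(n <- r) F x n i, \sum_(n <- r) F x n i⟩) s /\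
    cnorm s <= C * N x.
Proof.
move=> N0 hF; elim: r => [|n r [C [C0 IH]]].
  exists 0; split=> // x; exists 0; rewrite cnorm0 mul0r; split=> //.
  rewrite has_sum_innerE (_ : series _ = fun=> 0); first exact: norm_cvg_cst.
  apply/funext => n; rewrite /series /= big1// => i _; rewrite /zero_ext.
  by case: insub => [j|] /=; rewrite ?big_nil inner0l.
exists (2 * (`|c n| + C)); split; first by rewrite mulr_ge0// addr_ge0.
move=> x; have [s [hs sle]] := hF x n; have [t [ht tle]] := IH x.
have [u [hu ule]] := has_sum_innerD hs ht.
exists u; split.
  by under [X in has_sum X]eq_fun do rewrite big_cons.
by have := ler_norm (c n); have := N0 x; nra.
Qed.

(** [l2_norm] takes its sum by choice; uniqueness of limits identifies it with any known sum. *)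
Lemma l2_normE (u : l2 H J) s : has_sum (fun i => ⟨u i, u i⟩) s ->
  l2_norm u = Num.sqrt (cnorm s).
Proof.
move=> hs; rewrite /l2_norm; case: cid => t ht /=.
by rewrite (has_sum_unique ht hs).
Qed.

End SquareSummable.

(** * Order bounds for sums of inner products *)

Section ModuleDomination.
Context {R : realType} {A : cstarAlgType R} {H : hilbertModType A}.
Variable J : set nat.

(** For self-adjoint [h] the sum at [h *: x] is [h s h], so the norm bound at [h *: x] is the
    conjugated bound required for domination. *)
Lemma has_sum_le_of_cnorm_le (U : J -> endStar H) (r : R) :
  0 <= r ->
  (forall x s, has_sum (fun i => ⟨U i x, U i x⟩) s ->
    cnorm s <= r * cnorm ⟨x, x⟩) ->
  forall x s, has_sum (fun i => ⟨U i x, U i x⟩) s -> s ⪯ r%:C *: ⟨x, x⟩.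
Proof.
move=> r0 hle x s xs; apply: le_of_cnorm_conj_le => //.
- exact/sa_square_sa/(has_sum_inner_sa_square xs).
- exact: inner_sa_square.
move=> h sh; have -> : h * ⟨x, x⟩ * h = ⟨h *: x, h *: x⟩.
  by rewrite innerZl innerZr sh mulrA.
apply: hle; have := has_sum_innerZ h xs; rewrite sh.
by congr (has_sum _ _); apply/funext => i; rewrite endStarZ.
Qed.

Lemma le_has_sum_of_cnorm_le (V : H -> H) (U : J -> endStar H) (r : R) :
  (forall (a : A) x, V (a *: x) = a *: V x) -> 0 <= r ->
  (forall x s, has_sum (fun i => ⟨U i x, U i x⟩) s ->
    cnorm ⟨V x, V x⟩ <= r * cnorm s) ->
  forall x s, has_sum (fun i => ⟨U i x, U i x⟩) s -> ⟨V x, V x⟩ ⪯ r%:C *: s.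
Proof.
move=> VZ r0 hle x s xs; apply: le_of_cnorm_conj_le => //.
- exact/sa_square_sa/inner_sa_square.
- exact: has_sum_inner_sa_square xs.
move=> h sh; have -> : h * ⟨V x, V x⟩ * h = ⟨V (h *: x), V (h *: x)⟩.
  by rewrite VZ innerZl innerZr sh mulrA.
apply: hle; have := has_sum_innerZ h xs; rewrite sh.
by congr (has_sum _ _); apply/funext => i; rewrite endStarZ.
Qed.

End ModuleDomination.

(** * The frame property of the summed family *)

Lemma cstar_le_cnorm (R : realType) (A : cstarAlgType R) (a b : A) :
  cstar_pos a -> a ⪯ b -> cnorm a <= cnorm b.
Proof. by move=> /cstar_posP pa /cstar_posP pba; exact: sa_square_mono. Qed.

Theorem theorem5p9 (R : realType) (A : cstarAlgType R) (H : hilbertModType A)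
    (K : endStar H) (J : set nat) (k : nat)
    (T S : 'I_k -> J -> endStar H) (a b : 'I_k -> R)
    (hT : forall n : 'I_k, K_operator_frame_bounds K (T n) (a n) (b n))
    (L : l2 H J -> l2 H J) (hL : bounded_linear_l2 L) (p : 'I_k)
    (hLp : forall (x : H) (u : l2 H J),
      (forall i : J, u i = \sum_(n < k) S n i x) ->
      forall i : J, L u i = T p i x)
    (lambda : R) (hlambda : 0 < lambda)
    (hTS : forall (x : H) (n : 'I_k), exists s t : A,
      [/\ has_sum (fun i : J => ⟨(T n i - S n i) x, (T n i - S n i) x⟩) s,
          has_sum (fun i : J => ⟨T n i x, T n i x⟩) t &
          cnorm s <= lambda * cnorm t]) :
  K_operator_frame K (fun i : J => \sum_(n < k) S n i).
Proof.
pose U i := \sum_(n < k) S n i.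
have UE i x : U i x = \sum_(n < k) S n i x by exact: endStar_sum.
have T_le n x t : has_sum (fun i => ⟨T n i x, T n i x⟩) t ->
    cnorm t <= b n * cnorm ⟨x, x⟩.
  move=> ht; have [a0 b0 /(_ x) [t' [ht' _ tb]]] := hT n.
  rewrite (has_sum_unique ht ht') -(ger0_norm (ltW b0)) -cnormZr.
  apply: cstar_le_cnorm tb; apply/cstar_posP.
  exact: has_sum_inner_sa_square ht'.
(* Since [S = T - (T - S)], the sum has norm at most [2 (|t| + |d|) <= 2 (1 + lambda) |t|], and
   [|t| <= b n |<x, x>|]. *)
have S_le x n : exists s, has_sum (fun i => ⟨S n i x, S n i x⟩) s /\
    cnorm s <= (2 * (1 + lambda) * b n) * cnorm ⟨x, x⟩.
  have [d [t [hd ht dt]]] := hTS x n.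
  have [s [hs sle]] := has_sum_innerD ht (has_sum_innerN hd).
  exists s; split; last by have := T_le n x t ht; nra.
  move: hs; congr (has_sum _ _); apply/funext => i.
  by rewrite endStarB opprB addrC subrK.
have [C [C0 hC]] := has_sum_inner_sum (index_enum 'I_k)
  (fun x => cnorm_ge0 ⟨x, x⟩) S_le.
have U_sum x : exists s, has_sum (fun i => ⟨U i x, U i x⟩) s /\
    cnorm s <= C * cnorm ⟨x, x⟩.
  have [s [hs sle]] := hC x; exists s; split=> //; move: hs.
  by congr (has_sum _ _); apply/funext => i; rewrite UE.
have [_ [M LM]] := hL.
have T_le_U x s t : has_sum (fun i => ⟨U i x, U i x⟩) s ->
    has_sum (fun i => ⟨T p i x, T p i x⟩) t -> cnorm t <= M ^+ 2 * cnorm s.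
  move=> hs ht; pose u : l2 H J := L2 (ex_intro _ s hs).
  have Lu i : L u i = T p i x by apply: hLp => j; rewrite /= UE.
  have := LM u; rewrite (@l2_normE _ _ _ _ u s hs) (@l2_normE _ _ _ _ _ t); last first.
    by move: ht; congr (has_sum _ _); apply/funext => i; rewrite Lu.
  move=> h; have := cnorm_ge0 s; have := cnorm_ge0 t.
  move=> t0 s0; rewrite -(sqr_sqrtr t0) -(sqr_sqrtr s0) -exprMn.
  (* The sign of [M] is not given; [0 <= sqrt |t| <= M sqrt |s|] supplies the nonnegativity needed
     to compare squares. *)
  by rewrite ler_sqr// nnegrE ?sqrtr_ge0//; apply: le_trans h; exact: sqrtr_ge0.
have [a0 _ hTp] := hT p.
(* The summand [1] keeps [r] positive when [M = 0], so that [r^-1] can serve as lower frame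
   bound. *)
pose r := M ^+ 2 / a p + 1.
have r0 : 0 < r.
  by apply: ltr_wpDl => //; apply: divr_ge0 (sqr_ge0 M) (ltW a0).
have K_le x s : has_sum (fun i => ⟨U i x, U i x⟩) s ->
    cnorm ⟨adjoint K x, adjoint K x⟩ <= r * cnorm s.
  move=> hs; have [t [ht at_ _]] := hTp x.
  have := T_le_U x s t hs ht.
  have : cnorm ((a p)%:C *: ⟨adjoint K x, adjoint K x⟩) <= cnorm t.
    apply: cstar_le_cnorm at_; apply/cstar_posP; apply: sa_squareZ (ltW a0) _.
    exact: inner_sa_square.
  rewrite cnormZr gtr0_norm// => h1 h2.
  have := le_trans h1 h2; rewrite mulrC -ler_pdivlMr// => h.
  by apply: le_trans h _; rewrite /r; have := cnorm_ge0 s; lra.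
(* [C] is only known to be nonnegative, whereas a frame bound must be positive. *)
exists r^-1, (C + 1); split; [by rewrite invr_gt0 | by lra |].
move=> x; have [s [hs sle]] := U_sum x; exists s; split=> //.
- have /cstar_posP h := le_has_sum_of_cnorm_le (adjoint_endStarZ K) (ltW r0) K_le hs.
  apply/cstar_posP.
  have -> : s - r^-1%:C *: ⟨adjoint K x, adjoint K x⟩ =
      r^-1%:C *: (r%:C *: s - ⟨adjoint K x, adjoint K x⟩).
    by rewrite scalerBr scalerA -rmorphM mulVf ?gt_eqF// scale1r.
  by apply: sa_squareZ h; rewrite invr_ge0 ltW.
- apply: has_sum_le_of_cnorm_le hs; first by lra.
  move=> y t ht; have [t' [ht' tle]] := U_sum y.
  rewrite (has_sum_unique ht ht'); have := cnorm_ge0 ⟨y, y⟩; lra.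
Qed.
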